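(* Let $D_0$ be a $2^{(2n+6)-6}$ quaternary-code design defined by a frequency vector $F_0=(f_{ijk})_{i,j,k\in\mathbb{Z}_4}$, and assume that $$\sum_{i=1,3;\,j=1,3;\,k=0,2} f_{ijk}>0,\qquad \sum_{i=1,3;\,j=0,2;\,k=1,3} f_{ijk}>0,\qquad \sum_{i=0,2;\,j=1,3;\,k=1,3} f_{ijk}>0 .$$ Let $D_0$ have generalized resolution $R_0=r_0+1-\rho_0$. Then for every integer $t\ge0$, a $2^{(2n+126t+6)-6}$ quaternary-code design $D_t$ defined by the frequency vector $F_t=F_0+(0,\vec{1}_{63})t$ (that is, $f_{000}$ is unchanged and each of the other 63 frequencies is increased by $t$) has generalized resolution $R_t=r_t+1-\rho_t$, where $r_t=r_0+64t$, and $\rho_t=\rho_0\,2^{-16t}$ if $\rho_0<1$, while $\rho_t=1$ if $\rho_0=1$.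
   Context: Quaternary-code (QC) designs: let $\mathbb{Z}_4=\{0,1,2,3\}$ and let $G=(V,I_m)$ be an $m\times(m+3)$ generator matrix over $\mathbb{Z}_4$, where $V$ is $m\times3$ and $I_m$ is the identity. Form the $4^m\times(m+3)$ matrix whose rows are all linear combinations over $\mathbb{Z}_4$ of the rows of $G$, and replace each entry by two $\pm1$ entries via the Gray map $0\to(1,1)$, $1\to(1,-1)$, $2\to(-1,-1)$, $3\to(-1,1)$. The resulting $2^{2m}\times(2m+6)$ matrix with entries $\pm1$ is the $2^{(2m+6)-6}$ QC design (a $(1/64)$th-fraction) generated by $G$. Frequencies: for $i,j,k\in\mathbb{Z}_4$, $f_{ijk}$ is the number of rows of $V$ equal to $(i,j,k)$; the frequency vector is $F=(f_{000},f_{001},f_{002},f_{003},f_{010},\ldots,f_{333})$, with 64 entries in lexicographic order of indices, $f_{000}$ first. It determines $V$ up to row permutation, hence the design up to permutation of its rows and columns. $\vec{1}_{63}$ is the all-ones vector of length 63. Words and aliasing indexes: for a set $s$ of $k$ columns of a QC design $D$ with $N$ runs (rows), let $\rho_k(s)=\frac1N\bigl|\sum_{x}\prod_{c\in s}c_x\bigr|$, where $x$ runs over the $N$ rows and $c_x$ is the entry of column $c$ in row $x$. If $\rho_k(s)>0$, then $s$ is a word of length $k$ with aliasing index $\rho_k(s)$. Generalized resolution: $R=r+1-\rho$, where $r$ is the smallest $k\ge1$ for which some set $s$ of $k$ columns has $\rho_k(s)>0$, and $\rho=\max_{|s|=r}\rho_r(s)$ over all sets of $r$ columns. *)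

(* Defs.v *)
From HB Require Import structures.
From mathcomp Require Import all_boot all_order all_algebra.

Set Implicit Arguments.
Unset Strict Implicit.
Unset Printing Implicit Defensive.

Import Order.TTheory GRing.Theory Num.Theory.
Local Open Scope ring_scope.

Definition Z4_even : seq 'Z_4 := [:: 0; 2].
Definition Z4_odd : seq 'Z_4 := [:: 1; 3].

Definition gray (x : 'Z_4) : rat * rat :=
  match val x with
  | 0%N => (1, 1)
  | 1%N => (1, -1)
  | 2%N => (-1, -1)
  | _ => (-1, 1)
  end.

Section AliasingIndex.

Variables (Run Col : finType) (D : Run -> Col -> rat).

Definition aliasing_index (s : {set Col}) : rat :=
  `|\sum_(x : Run) \prod_(c in s) D x c| / #|Run|%:R.

Definition has_word_of_length (k : nat) : bool :=
  [exists s : {set Col}, (#|s| == k) && (0 < aliasing_index s)].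

(* The neutral element 0 is harmless: aliasing indexes are nonnegative. *)
Definition max_aliasing_of_length (k : nat) : rat :=
  \big[Num.max/0]_(s : {set Col} | #|s| == k) aliasing_index s.

End AliasingIndex.

Section QuaternaryCodeDesign.

Variables (m : nat) (V : 'M['Z_4]_(m, 3)).

Definition qc_generator : 'M['Z_4]_(m, 3 + m) := row_mx V 1%:M.

(* A run is indexed by the coefficient vector u of a linear combination of
   the rows of the generator.  The column (c, false), resp. (c, true), holds the first,
   resp. second, Gray coordinate of column c of the code. *)
Definition qc_design (u : 'rV['Z_4]_m) (c : 'I_(3 + m) * bool) : rat :=
  let g := gray ((u *m qc_generator) 0 c.1) in if c.2 then g.2 else g.1.

Definition frequency_vector : {ffun 'Z_4 * 'Z_4 * 'Z_4 -> nat} :=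
  [ffun w => #|[set l : 'I_m | (V l 0, V l 1, V l 2) == w]|].

(* Parseval: the squared character sums over all sets of columns add up to at
   least N * 2 ^ (2 m + 6), whereas the empty set contributes only
   N ^ 2 = N * 2 ^ (2 m). *)
Lemma qc_has_word :
  exists k, (0 < k)%N && has_word_of_length qc_design k.
Proof.
pose C := ('I_(3 + m) * bool)%type.
pose S (s : {set C}) := \sum_u \prod_(c in s) qc_design u c.
have D2 u c : qc_design u c * qc_design u c = 1.
  by rewrite /qc_design /gray; case: (val _) => [|[|[|?]]]; case: c.2; rewrite /= ?mulrNN mulr1.
have cardC : #|{: C}| = (m.*2 + 6)%N.
  by rewrite card_prod card_ord card_bool muln2 doubleD addnC.
have cardT : #|{: 'rV['Z_4]_m}| = (2 ^ m.*2)%N.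
  by rewrite card_mx mul1n card_ord -(expnM 2 2) mul2n.
have N0 : 0 < (2 ^ m.*2)%:R :> rat by rewrite ltr0n expn_gt0.
case: (boolP [exists s : {set C}, (0 < #|s|)%N && (S s != 0)]).
  case/existsP=> s /andP[s0 Ss]; exists #|s|; rewrite s0; apply/existsP; exists s.
  by rewrite eqxx /aliasing_index cardT divr_gt0 // normr_gt0.
move/existsPn => noword; exfalso.
have S0 : S set0 = (2 ^ m.*2)%:R.
  rewrite /S (eq_bigr (fun=> 1)) => [|u _]; last by rewrite big_set0.
  by rewrite sumr_const cardT.
have eqS : \sum_s S s ^+ 2 = (2 ^ m.*2)%:R ^+ 2.
  rewrite (bigD1 set0) //= S0 big1 ?addr0 // => s s0.
  by have := noword s; rewrite card_gt0 s0 /= negbK => /eqP->; rewrite expr0n.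
have eqS' : \sum_s S s ^+ 2 =
    \sum_u \sum_v \prod_(c : C) (qc_design u c * qc_design v c + 1).
  under [RHS]eq_bigr => u _ do under eq_bigr => v _ do rewrite bigA_distr.
  under [RHS]eq_bigr => u _ do rewrite exchange_big /=.
  rewrite exchange_big /=; apply: eq_bigr => s _.
  rewrite expr2 big_distrlr; apply: eq_bigr => u _; apply: eq_bigr => v _ /=.
  rewrite -big_mkcond -big_split /=.
  by apply: eq_bigr => c _.
have D1 u v c : 0 <= qc_design u c * qc_design v c + 1.
  have : (qc_design u c * qc_design v c) ^+ 2 = 1 by rewrite exprMn !expr2 !D2 mulr1.
  move/eqP; rewrite sqrf_eq1 => /orP[]/eqP->; last by rewrite addNr.
  by rewrite addr_ge0.
have : (2 ^ m.*2)%:R * (2 ^ (m.*2 + 6))%:R <= \sum_s S s ^+ 2.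
  rewrite eqS'.
  have -> : (2 ^ m.*2)%:R * (2 ^ (m.*2 + 6))%:R
          = \sum_(u : 'rV['Z_4]_m) (2 ^ (m.*2 + 6))%:R :> rat.
    by rewrite sumr_const cardT mulr_natl.
  apply: ler_sum => u _; rewrite (bigD1 u) //= -[leLHS]addr0 lerD //.
    rewrite (eq_bigr (fun=> 2)) => [|c _]; last by rewrite D2.
    by rewrite prodr_const cardC natrX.
  by apply: sumr_ge0 => v _; apply: prodr_ge0.
rewrite eqS expr2 ler_pM2l // ler_nat leqNgt ltn_exp2l //.
by rewrite -[ltnLHS]addn0 ltn_add2l.
Qed.

Definition shortest_word_length : nat := ex_minn qc_has_word.

Definition max_shortest_aliasing : rat :=
  max_aliasing_of_length qc_design shortest_word_length.

Definition generalized_resolution : rat :=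
  shortest_word_length%:R + 1 - max_shortest_aliasing.

End QuaternaryCodeDesign.

(* Main.v *)
Require Import Defs.
From mathcomp Require Import all_boot all_order all_algebra all_field.
From mathcomp Require Import ring zify.

(* Expanding each Gray-coded column in the characters of Z_4 turns the character sum of a
   set s of columns into a sum over the dual code, whose words are (lam, - lam V^T) for lam
   in Z_4^3; only the dual words with the same Lee weights as s in every coordinate contribute.
   Under the parity hypotheses at most one pair {lam, - lam} contributes, so the words of the
   design have as lengths the Lee weights of the nonzero dual words, with maximal aliasing
   2^-floor((q - 1) / 2), where q is the number of odd coordinates (aliasing 1 if q = 0).
   Adding t copies of the 63 nonzero rows increases every nonzero Lee weight by 64 t, and q by
   32 t when lam has an odd coordinate, while q stays 0 otherwise.  Hence the minimizing lam do
   not change.  The parity hypotheses also force q >= 3 for every lam with an odd coordinate, so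
   that rho_0 = 1 exactly when some minimizing lam is even. *)

Set Implicit Arguments.
Unset Strict Implicit.
Unset Printing Implicit Defensive.

Import Order.TTheory GRing.Theory Num.Theory.
Local Open Scope ring_scope.

(** * Characters of Z_4 and their orthogonality *)

Definition Z4_enum : seq 'Z_4 := [:: 0; 1; 2; 3].

Lemma mem_Z4_enum (x : 'Z_4) : x \in Z4_enum.
Proof. by case: x => [[|[|[|[|[]]]]] ?]. Qed.

Lemma big_Z4 (R : Type) (idx : R) (op : Monoid.law idx) (f : 'Z_4 -> R) :
  \big[op/idx]_x f x = \big[op/idx]_(x <- Z4_enum) f x.
Proof.
rewrite !big_ord_recl big_ord0 !big_cons big_nil.
by congr (op (f _) (op (f _) (op (f _) (op (f _) _)))); apply: val_inj.
Qed.

Definition lee (x : 'Z_4) : nat := minn x (4 - x).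

Lemma leeN x : lee (- x) = lee x.
Proof. by case: x => [[|[|[|[|[]]]]] ?]. Qed.

Lemma oddZ4N (x : 'Z_4) : odd (- x)%R = odd x.
Proof. by case: x => [[|[|[|[|[]]]]] ?]. Qed.

Definition chi (x : 'Z_4) : algC := 'i ^+ x.

Lemma expi4 : 'i ^+ 4 = 1 :> algC.
Proof. by rewrite (exprM _ 2 2) sqrCi sqrrN expr1n. Qed.

Lemma chiD x y : chi (x + y) = chi x * chi y.
Proof. by rewrite /chi -exprD -[RHS](expr_mod _ expi4). Qed.

Lemma chi_sum (I : finType) (f : I -> 'Z_4) : chi (\sum_i f i) = \prod_i chi (f i).
Proof. by apply: (big_morph chi chiD). Qed.

Lemma N1_neq1 : -1 != 1 :> algC.
Proof. by rewrite eq_sym -subr_eq0 opprK -(natrD _ 1 1) pnatr_eq0. Qed.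

Lemma chi_eq1 x : (chi x == 1) = (x == 0).
Proof.
have iN (c : algC) : c ^+ 2 = -1 -> c != 1.
  by move=> c2; apply/eqP => c1; have := N1_neq1; rewrite -c2 c1 expr1n eqxx.
rewrite -val_eqE /chi; case: x => [[|[|[|[|[]]]]] lx] //=.
- by rewrite expr0 !eqxx.
- by rewrite expr1 (negPf (iN _ (sqrCi _))).
- by rewrite sqrCi (negPf N1_neq1).
- by rewrite exprS sqrCi mulrN1 (negPf (iN _ _)) // sqrrN sqrCi.
Qed.

(** If [g i 0 != 0], translating [u] by the [i]-th unit vector multiplies the sum by
    [chi (g i 0) != 1], so the sum vanishes. *)
Lemma sum_chi m (g : 'cV['Z_4]_m) :
  \sum_(u : 'rV_m) chi ((u *m g) 0 0) = if g == 0 then (4 ^ m)%:R else 0.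
Proof.
have [-> | g0] := eqVneq.
  under eq_bigr => u _ do rewrite mulmx0 mxE.
  by rewrite sumr_const card_mx mul1n card_ord.
have [i gi] : exists i, g i 0 != 0.
  by apply/existsP; apply: contraNT g0 => /existsPn gi0; apply/eqP/matrixP => i j;
    rewrite mxE ord1; apply/eqP; rewrite -[_ == _]negbK.
set S := \sum_u _; have eqS : S = chi (g i 0) * S.
  rewrite {1}/S (reindex_inj (addrI (delta_mx 0 i))) mulr_sumr; apply: eq_bigr => u _.
  by rewrite mulmxDl mxE chiD -rowE mxE.
apply/eqP; have /eqP := eqS; rewrite -subr_eq0 -{1}[S]mul1r -mulrBl mulf_eq0 subr_eq0.
by rewrite eq_sym chi_eq1 (negPf gi).
Qed.

(** * Fourier expansion of the Gray coordinates *)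

Definition gray_prod (b : bool * bool) (x : 'Z_4) : rat :=
  (if b.1 then (gray x).1 else 1) * (if b.2 then (gray x).2 else 1).

(* The coefficient of the character [fun x => chi (l * x)] in [gray_prod b]: for a single Gray
   coordinate it is (1 - i)/2 or (1 + i)/2, at the odd l. *)
Definition gray_coef (b : bool * bool) (l : 'Z_4) : algC :=
  match b with
  | (false, false) => (l == 0)%:R
  | (true, true) => (l == 2)%:R
  | (b1, _) => if odd l then (1 + (-1) ^+ ((l == 1) == b1) * 'i) / 2 else 0
  end.

Lemma gray_prod_chi b x :
  ratr (gray_prod b x) = \sum_l gray_coef b l * chi (l * x).
Proof.
have i3 : 'i ^+ 3 = - 'i :> algC by rewrite exprS sqrCi mulrN1.
rewrite big_Z4 !big_cons big_nil /chi /gray_prod.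
case: b => [[] []]; case: x => [[|[|[|[|[]]]]] lx] //=; rewrite /gray_coef /gray /=;
  rewrite ?mulr1 ?mul1r ?mulrNN ?rmorphN ?rmorph1 ?i3 ?sqrCi ?expr0 ?expr1;
  by field: (sqrCi algC).
Qed.

(** A real function has conjugate Fourier coefficients at opposite characters. *)
Lemma gray_coefN b l : gray_coef b (- l) = (gray_coef b l)^*.
Proof.
case: b => [[] []]; case: l => [[|[|[|[|[]]]]] ?] //=; rewrite /gray_coef /= ?conjC0 ?conjC1 //;
  rewrite ?expr0 ?expr1 rmorphM rmorphD rmorphM fmorphV /= ?rmorphN ?rmorph1 conjCi rmorph_nat;
  ring.
Qed.

(** This links lengths to Lee weights: a dual word contributes to a set of columns only if its Lee
    weight in each coordinate is the number of Gray coordinates chosen there. *)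
Lemma gray_coef_neq0 b l : (gray_coef b l != 0) = (b.1 + b.2 == lee l)%N.
Proof.
have n0 (c : algC) : c ^+ 2 = -1 -> 1 + c != 0.
  move=> c2; apply/eqP => /eqP; rewrite addrC addr_eq0 => /eqP c1.
  by have := N1_neq1; rewrite -c2 c1 sqrrN expr1n eqxx.
case: b => [[] []]; case: l => [[|[|[|[|[]]]]] ?] //=; rewrite /gray_coef /= ?eqxx ?oner_eq0 //;
  by rewrite mulf_neq0 ?invr_eq0 ?pnatr_eq0 // n0 // ?expr0 ?expr1 ?mul1r ?mulN1r ?sqrrN sqrCi.
Qed.

(** Up to a power of i, a nonzero coefficient depends only on the parity of [l], so a product of
    them is governed by the number of odd coordinates. *)
Lemma gray_coef_form b l : gray_coef b l != 0 ->
  exists k, gray_coef b l = 'i ^+ k * ((1 + 'i) / 2) ^+ odd l.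
Proof.
case: b => [[] []]; case: l => [[|[|[|[|[]]]]] ?] //=; rewrite /gray_coef /= ?eqxx // => _.
all: try by exists 0%N; rewrite ?expr0 ?mulr1 ?expr1 ?mul1r.
(* The remaining coefficient is (1 - i)/2, and 1 - i = i^3 (1 + i). *)
all: exists 3; rewrite !expr1 (exprS 'i 2) sqrCi; ring: (sqrCi algC).
Qed.

(** * Aliasing indexes as sums over the dual code *)

Definition col_type (A : finType) (s : {set A * bool}) (j : A) : bool * bool :=
  ((j, false) \in s, (j, true) \in s).

Lemma prod_qc_design m (V : 'M_(m, 3)) u (s : {set 'I_(3 + m) * bool}) :
  \prod_(c in s) qc_design V u c =
  \prod_j gray_prod (col_type s j) ((u *m qc_generator V) 0 j).
Proof.
transitivity (\prod_j \prod_b (if (j, b) \in s then qc_design V u (j, b) else 1)).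
  by rewrite big_mkcond pair_bigA; apply: eq_bigr => -[].
by apply: eq_bigr => j _; rewrite big_bool [LHS]mulrC.
Qed.

Lemma card_col_type (A : finType) (s : {set A * bool}) :
  #|s| = (\sum_j ((col_type s j).1 + (col_type s j).2))%N.
Proof.
transitivity (\sum_j \sum_b ((j, b) \in s))%N.
  by rewrite -sum1_card big_mkcond pair_bigA; apply: eq_bigr => -[j b] _; case: ifP.
by apply: eq_bigr => j _; rewrite big_bool addnC.
Qed.

Definition dual_word m (V : 'M['Z_4]_(m, 3)) (lam : 'rV['Z_4]_3) : 'rV_(3 + m) :=
  row_mx lam (- (lam *m V^T)).

(* The words orthogonal to the rows of the generator [V | I] are the rows [lam | - lam V^T]. *)
Lemma dual_wordP m (V : 'M_(m, 3)) (l : 'rV_(3 + m)) :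
  (qc_generator V *m l^T == 0) = (l == dual_word V (lsubmx l)).
Proof.
rewrite -{1 2}[l]hsubmxK tr_row_mx mul_row_col mul1mx addrC addr_eq0.
apply/eqP/eqP => [e | /eq_row_mx[_ ->]].
  by congr row_mx; rewrite -[LHS]trmxK e linearN /= trmx_mul trmxK.
by rewrite linearN /= trmx_mul trmxK.
Qed.

Definition dual_term m (V : 'M_(m, 3)) (s : {set 'I_(3 + m) * bool}) lam : algC :=
  \prod_j gray_coef (col_type s j) (dual_word V lam 0 j).

Lemma aliasing_index_dual m (V : 'M_(m, 3)) s :
  ratr (aliasing_index (qc_design V) s) = `|\sum_lam dual_term V s lam| :> algC.
Proof.
rewrite /aliasing_index rmorphM fmorphV rmorph_nat /= ratr_norm rmorph_sum /=.
have -> : \sum_u ratr (\prod_(c in s) qc_design V u c) =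
    (4 ^ m)%:R * \sum_lam dual_term V s lam :> algC; last first.
  rewrite normrM normr_nat mulrC card_mx mul1n card_ord mulKf //.
  by rewrite pnatr_eq0 expn_eq0.
(* Expanding the product over the columns chooses one character [f j] for each column. *)
transitivity (\sum_(u : 'rV_m) \sum_(f : {ffun 'I_(3 + m) -> 'Z_4})
   \prod_j (gray_coef (col_type s j) (f j) *
            chi (f j * (u *m qc_generator V) 0 j))).
  apply: eq_bigr => u _; rewrite prod_qc_design rmorph_prod.
  rewrite -(bigA_distr_bigA (fun j l =>
    gray_coef (col_type s j) l * chi (l * (u *m qc_generator V) 0 j))) /=.
  by apply: eq_bigr => j _; rewrite gray_prod_chi.
rewrite exchange_big /=.
rewrite (reindex (fun l : 'rV_(3 + m) => [ffun j => l 0 j])) /=; last first.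
  exists (fun f : {ffun 'I_(3 + m) -> 'Z_4} => \row_j f j) => [l _ | f _].
    by apply/rowP => j; rewrite mxE ffunE.
  by apply/ffunP => j; rewrite ffunE mxE.
(* Summing over the runs first, orthogonality keeps only the words of the dual code, each with the
   factor 4^m. *)
transitivity (\sum_(l : 'rV_(3 + m) | qc_generator V *m l^T == 0)
    (4 ^ m)%:R * \prod_j gray_coef (col_type s j) (l 0 j)).
  rewrite [RHS]big_mkcond; apply: eq_bigr => l _.
  transitivity (\prod_j gray_coef (col_type s j) (l 0 j) *
     \sum_(u : 'rV_m) chi ((u *m (qc_generator V *m l^T)) 0 0)).
    rewrite mulr_sumr; apply: eq_bigr => u _; rewrite big_split /= -chi_sum.
    congr (_ * chi _); first by apply: eq_bigr => j _; rewrite ffunE.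
    by rewrite mulmxA mxE; apply: eq_bigr => j _; rewrite ffunE !mxE mulrC.
  by rewrite sum_chi mulrC; case: ifP; rewrite ?mul0r.
rewrite -mulr_sumr; congr (_ * _).
rewrite (reindex_onto (dual_word V) lsubmx) /= => [|l]; last first.
  by rewrite dual_wordP => /eqP.
by apply: eq_bigl => lam; rewrite dual_wordP /dual_word row_mxKl !eqxx.
Qed.

(** * Weights and parities of dual words *)

Definition dot (a w : 'Z_4 * 'Z_4 * 'Z_4) : 'Z_4 :=
  a.1.1 * w.1.1 + a.1.2 * w.1.2 + a.2 * w.2.

Definition row_triple m (V : 'M['Z_4]_(m, 3)) (i : 'I_m) : 'Z_4 * 'Z_4 * 'Z_4 :=
  (V i 0, V i 1, V i 2).

Local Notation triple lam := (row_triple lam 0).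

Lemma big_I3 (R : Type) (idx : R) (op : Monoid.law idx) (f : 'I_3 -> R) :
  \big[op/idx]_i f i = op (op (f 0) (f 1)) (f 2).
Proof.
rewrite !big_ord_recl big_ord0 Monoid.mulm1 Monoid.mulmA.
by congr (op (op (f _) (f _)) (f _)); apply: val_inj.
Qed.

Lemma triple_inj : injective (fun lam : 'rV['Z_4]_3 => triple lam).
Proof.
move=> a b [e0 e1 e2]; apply/rowP => j.
have : \big[andb/true]_i (a 0 i == b 0 i) by rewrite big_I3 e0 e1 e2 !eqxx.
by rewrite big_andE => /forallP/(_ j)/eqP.
Qed.

Lemma dual_word_lshift m (V : 'M_(m, 3)) lam j : dual_word V lam 0 (lshift m j) = lam 0 j.
Proof. exact: row_mxEl. Qed.

Lemma dual_word_rshift m (V : 'M_(m, 3)) lam i :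
  dual_word V lam 0 (rshift 3 i) = - dot (triple lam) (row_triple V i).
Proof. by rewrite row_mxEr !mxE big_I3 !mxE. Qed.

Lemma dual_wordN m (V : 'M_(m, 3)) lam : dual_word V (- lam) = - dual_word V lam.
Proof. by rewrite /dual_word opp_row_mx mulNmx. Qed.

Definition word_length m (V : 'M_(m, 3)) lam : nat := \sum_j lee (dual_word V lam 0%R j).

Definition odd_count m (V : 'M_(m, 3)) lam : nat := \sum_j odd (dual_word V lam 0%R j).

(** Evenness of [f] absorbs the sign in the block [- (lam *m V^T)]; the first three coordinates are
    those of [lam]. *)
Lemma sum_dual_word m (V : 'M_(m, 3)) lam (f : 'Z_4 -> nat) : (forall x, f (- x) = f x) ->
  (\sum_j f (dual_word V lam 0%R j) =
   f (lam 0 0)%R + f (lam 0 1)%R + f (lam 0 2)%R + \sum_i f (dot (triple lam) (row_triple V i)))%N.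
Proof.
move=> fN; rewrite big_split_ord /= big_I3 !dual_word_lshift; congr (_ + _)%N.
by apply: eq_bigr => i _; rewrite dual_word_rshift fN.
Qed.

Lemma sum_row_triple m (V : 'M_(m, 3)) (f : 'Z_4 * 'Z_4 * 'Z_4 -> nat) :
  (\sum_i f (row_triple V i) = \sum_w frequency_vector V w * f w)%N.
Proof.
rewrite (partition_big (row_triple V) predT) //=; apply: eq_bigr => w _.
rewrite (eq_bigr (fun=> f w)) => [|i /eqP-> //].
by rewrite sum_nat_const ffunE cardsE.
Qed.

Lemma odd_Z4D (x y : 'Z_4) : odd (x + y)%R = odd x (+) odd y.
Proof. by case: x => [[|[|[|[|[]]]]] ?]; case: y => [[|[|[|[|[]]]]] ?]. Qed.

Lemma odd_Z4M (x y : 'Z_4) : odd (x * y)%R = odd x && odd y.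
Proof. by case: x => [[|[|[|[|[]]]]] ?]; case: y => [[|[|[|[|[]]]]] ?]. Qed.

Lemma odd_dot a w : odd (dot a w) =
  (odd a.1.1 && odd w.1.1) (+) (odd a.1.2 && odd w.1.2) (+) (odd a.2 && odd w.2).
Proof. by rewrite !odd_Z4D !odd_Z4M. Qed.

Lemma odd_Z4_neqN (x : 'Z_4) : (x == - x) = ~~ odd x.
Proof. by case: x => [[|[|[|[|[]]]]] ?]. Qed.

Lemma eqN_odd_count m (V : 'M_(m, 3)) lam : lam = - lam -> odd_count V lam = 0%N.
Proof.
move=> e; rewrite /odd_count big1 // => j _.
have /eqP : dual_word V lam 0 j = - dual_word V lam 0 j by rewrite {1}e dual_wordN mxE.
by rewrite odd_Z4_neqN => /negPf->.
Qed.

Lemma neqN_odd (lam : 'rV['Z_4]_3) : lam != - lam -> exists j, odd (lam 0 j).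
Proof.
move=> lamN; apply/existsP; apply: contraNT lamN => /existsPn o.
by apply/eqP/rowP => j; rewrite !mxE; apply/eqP; rewrite odd_Z4_neqN o.
Qed.

(** * Consequences of the parity hypotheses *)

Definition parity (w : 'Z_4 * 'Z_4 * 'Z_4) : bool * bool * bool := (odd w.1.1, odd w.1.2, odd w.2).

Definition separating m (V : 'M_(m, 3)) : Prop :=
  [/\ exists i, parity (row_triple V i) = (true, true, false),
      exists i, parity (row_triple V i) = (true, false, true)
    & exists i, parity (row_triple V i) = (false, true, true)].

(** Modulo 2, [lam] becomes a nonzero (a, b, c), and the three given rows yield a + b, a + c, b + c.
    Together with a, b, c at least three of these six bits are 1. *)
Lemma neqN_odd_count m (V : 'M_(m, 3)) lam :
  separating V -> lam != - lam -> (3 <= odd_count V lam)%N.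
Proof.
case=> -[i1 e1] [i2 e2] [i3 e3] /neqN_odd[j oj].
rewrite /odd_count (@sum_dual_word _ _ _ (fun x => nat_of_bool (odd x))) => [|x];
  last by rewrite oddZ4N.
have n21 : i2 != i1 by apply: contra_eq_neq e2 => ->; rewrite e1.
have n31 : i3 != i1 by apply: contra_eq_neq e3 => ->; rewrite e1.
have n32 : i3 != i2 by apply: contra_eq_neq e3 => ->; rewrite e2.
rewrite (bigD1 i1) // (bigD1 i2) ?n21 // (bigD1 i3) ?n31 // !odd_dot.
case: e1 => -> -> ->; case: e2 => -> -> ->; case: e3 => -> -> -> /=.
have : odd (lam 0 0) || odd (lam 0 1) || odd (lam 0 2).
  apply: contraTT oj; rewrite !negb_or => /andP[/andP[n0 n1] n2].
  have : \big[andb/true]_i ~~ odd (lam 0 i) by rewrite big_I3 n0 n1 n2.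
  by rewrite big_andE => /forallP/(_ j).
by case: (odd _); case: (odd _); case: (odd _); rewrite //= !addnA.
Qed.

(** Explicit lists make the exhaustive checks over Z_4^3 computable. *)
Definition Z4_triples (A B C : seq 'Z_4) : seq ('Z_4 * 'Z_4 * 'Z_4) :=
  [seq (x, y) | x <- [seq (x, y) | x <- A, y <- B], y <- C].

Lemma mem_parity w : w \in
  (let f (b : bool) := if b then Z4_odd else Z4_even in
   Z4_triples (f (parity w).1.1) (f (parity w).1.2) (f (parity w).2)).
Proof.
have H (x : 'Z_4) : x \in (if odd x then Z4_odd else Z4_even) by case: x => [[|[|[|[|[]]]]] ?].
by case: w => [[x y] z]; rewrite /= allpairs_f // allpairs_f.
Qed.

Definition lee_agree (a b w : 'Z_4 * 'Z_4 * 'Z_4) := lee (dot a w) == lee (dot b w).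

Definition opp_triple (a : 'Z_4 * 'Z_4 * 'Z_4) := (- a.1.1, - a.1.2, - a.2).

(* Nested conditionals, because [vm_compute] evaluates both arguments of [&&]. *)
Lemma lee_agree_separating :
  all (fun a => all (fun b =>
    if [&& lee a.1.1 == lee b.1.1, lee a.1.2 == lee b.1.2 & lee a.2 == lee b.2] then
      if has (lee_agree a b) (Z4_triples Z4_odd Z4_odd Z4_even) then
        if has (lee_agree a b) (Z4_triples Z4_odd Z4_even Z4_odd) then
          if has (lee_agree a b) (Z4_triples Z4_even Z4_odd Z4_odd) then
            (b == a) || (b == opp_triple a)
          else true
        else true
      else true
    else true)
  (Z4_triples Z4_enum Z4_enum Z4_enum)) (Z4_triples Z4_enum Z4_enum Z4_enum).
Proof. by vm_compute. Qed.

Lemma mem_Z4_triples_enum w : w \in Z4_triples Z4_enum Z4_enum Z4_enum.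
Proof. by case: w => [[x y] z]; rewrite !allpairs_f ?mem_Z4_enum. Qed.

Lemma triple_opp (lam : 'rV_3) : triple (- lam) = opp_triple (triple lam).
Proof. by rewrite /row_triple !mxE. Qed.

(** The first three coordinates and one row from each of the three parity classes already determine
    [lam] up to sign, by the exhaustive check above. *)
Lemma dual_word_separating m (V : 'M_(m, 3)) lam lam' : separating V ->
  (forall j, lee (dual_word V lam 0 j) = lee (dual_word V lam' 0 j)) ->
  lam' = lam \/ lam' = - lam.
Proof.
case=> -[i1 e1] [i2 e2] [i3 e3] agree.
have agreeV i : lee_agree (triple lam) (triple lam') (row_triple V i).
  by have := agree (rshift 3 i); rewrite !dual_word_rshift !leeN => /eqP.
have agreeL j : lee (lam 0 j) = lee (lam' 0 j).
  by have := agree (lshift m j); rewrite !dual_word_lshift.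
have hasV i s : row_triple V i \in s -> has (lee_agree (triple lam) (triple lam')) s.
  by move=> ?; apply/hasP; exists (row_triple V i).
have /hasV h1 := mem_parity (row_triple V i1); rewrite e1 in h1.
have /hasV h2 := mem_parity (row_triple V i2); rewrite e2 in h2.
have /hasV h3 := mem_parity (row_triple V i3); rewrite e3 in h3.
have /allP/(_ _ (mem_Z4_triples_enum (triple lam)))/allP
  /(_ _ (mem_Z4_triples_enum (triple lam'))) := lee_agree_separating.
rewrite h1 h2 h3 !agreeL !eqxx /=.
by rewrite -triple_opp => /orP[]/eqP/triple_inj; [left | right].
Qed.

(** * From positive frequencies to rows of given parity *)

Lemma frequency_gt0 m (V : 'M_(m, 3)) (A B C : seq 'Z_4) :
  (0 < \sum_(i <- A) \sum_(j <- B) \sum_(k <- C) frequency_vector V (i, j, k))%N ->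
  exists2 w, w \in Z4_triples A B C & exists i, row_triple V i = w.
Proof.
move=> F_gt0.
have /hasP[w wABC Fw] : has (fun w => 0 < frequency_vector V w)%N (Z4_triples A B C).
  apply: contraTT F_gt0 => /hasPn F0; rewrite -leqNgt leqn0.
  rewrite big1_seq // => x /= xA; rewrite big1_seq // => y /= yB.
  rewrite big1_seq // => z /= zC; apply/eqP; rewrite -leqn0 leqNgt F0 //.
  by rewrite !allpairs_f.
exists w => //; move: Fw; rewrite ffunE card_gt0 => /set0Pn[i].
by rewrite inE => /eqP; exists i.
Qed.

Lemma separating_frequency m (V : 'M_(m, 3)) :
  let F := frequency_vector V in
  (0 < \sum_(i <- Z4_odd) \sum_(j <- Z4_odd) \sum_(k <- Z4_even) F (i, j, k))%N ->
  (0 < \sum_(i <- Z4_odd) \sum_(j <- Z4_even) \sum_(k <- Z4_odd) F (i, j, k))%N ->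
  (0 < \sum_(i <- Z4_even) \sum_(j <- Z4_odd) \sum_(k <- Z4_odd) F (i, j, k))%N ->
  separating V.
Proof.
have parityP A B C w a b c : w \in Z4_triples A B C ->
    {in A, forall x, odd (x : 'Z_4) = a} -> {in B, forall x, odd (x : 'Z_4) = b} ->
    {in C, forall x, odd (x : 'Z_4) = c} -> parity w = (a, b, c).
  case/allpairsP => -[xy z] [/allpairsP[[x y] [xA yB ->]] zC ->] /= hA hB hC.
  by congr (_, _, _); [exact: hA | exact: hB | exact: hC].
have oddP : {in Z4_odd, forall x, odd (x : 'Z_4) = true}.
  by move=> x; rewrite !inE => /orP[]/eqP->.
have evenP : {in Z4_even, forall x, odd (x : 'Z_4) = false}.
  by move=> x; rewrite !inE => /orP[]/eqP->.
move=> F /frequency_gt0[w1 w1P [i1 e1]] /frequency_gt0[w2 w2P [i2 e2]].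
move=> /frequency_gt0[w3 w3P [i3 e3]].
by split; [exists i1 | exists i2 | exists i3]; rewrite ?e1 ?e2 ?e3; apply: parityP; eauto.
Qed.

(** * Total weights over Z_4^3 and the change of frequencies *)

Lemma big_Z4_triple (f : 'Z_4 * 'Z_4 * 'Z_4 -> nat) :
  (\sum_w f w = sumn (map f (Z4_triples Z4_enum Z4_enum Z4_enum)))%N.
Proof.
rewrite sumnE big_map !big_allpairs -big_Z4.
under [RHS]eq_bigr => x _ do (rewrite -big_Z4; under eq_bigr => y _ do rewrite -big_Z4).
by rewrite !pair_bigA /=; apply: eq_bigr => -[[]].
Qed.

(** The map [dot a] is equidistributed on its image, Z_4 or {0, 2}, and the mean Lee weight is 1 on
    both. *)
Lemma sum_lee_dot a : a != (0, 0, 0) -> (\sum_w lee (dot a w) = 64)%N.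
Proof.
rewrite big_Z4_triple => a0; apply/eqP; move: a0; apply/implyP; move: a.
suff /allP H : all (fun a => (a != (0, 0, 0)) ==>
    (sumn (map (fun w => lee (dot a w)) (Z4_triples Z4_enum Z4_enum Z4_enum)) == 64)%N)
    (Z4_triples Z4_enum Z4_enum Z4_enum).
  by move=> a; apply: H; apply: mem_Z4_triples_enum.
by vm_compute.
Qed.

(** Here [a] has an odd entry, so [dot a] is onto Z_4 and takes odd values half of the time. *)
Lemma sum_odd_dot a : a != opp_triple a -> (\sum_w odd (dot a w) = 32)%N.
Proof.
rewrite big_Z4_triple => a0; apply/eqP; move: a0; apply/implyP; move: a.
suff /allP H : all (fun a => (a != opp_triple a) ==>
    (sumn (map (fun w => nat_of_bool (odd (dot a w)))
               (Z4_triples Z4_enum Z4_enum Z4_enum)) == 32)%N)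
    (Z4_triples Z4_enum Z4_enum Z4_enum).
  by move=> a; apply: H; apply: mem_Z4_triples_enum.
by vm_compute.
Qed.

(** The zero row keeps its frequency, but it contributes [f 0 = 0], so the added rows may be summed
    over all of Z_4^3. *)
Lemma sum_dual_word_shift (f : 'Z_4 -> nat) m m' (V : 'M_(m, 3)) (V' : 'M_(m', 3)) lam t :
  f 0 = 0%N -> (forall x, f (- x) = f x) ->
  frequency_vector V' = [ffun w => if w == (0, 0, 0) then frequency_vector V w
                                   else (frequency_vector V w + t)%N] ->
  (\sum_j f (dual_word V' lam 0%R j) =
   \sum_j f (dual_word V lam 0%R j) + t * \sum_w f (dot (triple lam) w))%N.
Proof.
move=> f0 fN FV'; rewrite !sum_dual_word // -[RHS]addnA; congr (_ + _)%N.
pose g w := f (dot (triple lam) w).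
have := sum_row_triple V' g; have := sum_row_triple V g; rewrite /g => -> ->.
rewrite FV' big_distrr -big_split.
apply: eq_bigr => w _; rewrite ffunE /=; case: eqP => [-> | _]; last by rewrite mulnDl.
by rewrite /dot /= !mulr0 !addr0 f0 !muln0.
Qed.

(** * Aliasing index of a given set of columns *)

(** Since ((1 + i)/2)^2 = i/2, lowering [q] by 2 raises [k] by 1 and doubles the norm. The base
    cases are q = 1, with norm 1, and q = 2, with norm 0 or 1 according to the parity of [k]. *)
Lemma norm_half_1Di_exp (k q : nat) : (0 < q)%N ->
  let z := 'i ^+ k * ((1 + 'i) / 2) ^+ q : algC in
  `|z + z^*| = 0 \/ `|z + z^*| = 2 ^- (q.-1)./2.
Proof.
have [h qh] : exists h, (q <= h)%N by exists q.
elim: h q k qh => [|h IH] [|[|[|q]]] k //= qh _; last 1 first.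
- have -> : 'i ^+ k * ((1 + 'i) / 2) ^+ q.+3 = ('i ^+ k.+1 * ((1 + 'i) / 2) ^+ q.+1) / 2 :> algC.
    by rewrite !(exprS _ q.+2) !(exprS _ q.+1) (exprS _ k); field: (sqrCi algC).
  rewrite rmorphM fmorphV rmorph_nat -mulrDl normrM normfV normr_nat.
  case: (IH q.+1 k.+1 _ isT); first by rewrite ltnW.
    by move=> ->; left; rewrite mul0r.
  by move=> ->; right; rewrite /= exprS invfM mulrC.
- rewrite -(expr_mod k expi4) expr1 expr0 invr1; right.
  rewrite !rmorphM rmorphXn fmorphV rmorphD /= conjCi rmorph1 rmorph_nat.
  have : (k %% 4 < 4)%N by rewrite ltn_mod.
  case: (k %% 4)%N => [|[|[|[|]]]] // _.
  + by rewrite -[RHS]normr1; congr `|_|; field.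
  + by rewrite -[RHS]normrN1; congr `|_|; field: (sqrCi algC).
  + by rewrite -[RHS]normrN1; congr `|_|; field: (sqrCi algC).
  + by rewrite -[RHS]normr1; congr `|_|; field: (sqrCi algC).
- rewrite -(expr_mod k expi4) expr0 invr1.
  rewrite rmorphM !rmorphXn rmorphM fmorphV rmorphD /= conjCi rmorph1 rmorph_nat.
  have : (k %% 4 < 4)%N by rewrite ltn_mod.
  case: (k %% 4)%N => [|[|[|[|]]]] // _.
  + by left; apply/eqP; rewrite normr_eq0; apply/eqP; field: (sqrCi algC).
  + by right; rewrite -[RHS]normrN1; congr `|_|; field: (sqrCi algC).
  + by left; apply/eqP; rewrite normr_eq0; apply/eqP; field: (sqrCi algC).
  + by right; rewrite -[RHS]normr1; congr `|_|; field: (sqrCi algC).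
Qed.

Lemma dual_termN m (V : 'M_(m, 3)) s lam : dual_term V s (- lam) = (dual_term V s lam)^*.
Proof.
rewrite /dual_term rmorph_prod; apply: eq_bigr => j _.
by rewrite dual_wordN mxE gray_coefN.
Qed.

Lemma dual_term_neq0 m (V : 'M_(m, 3)) (s : {set 'I_(3 + m) * bool}) lam :
  dual_term V s lam != 0 ->
  forall j, ((col_type s j).1 + (col_type s j).2 = lee (dual_word V lam 0%R j))%N.
Proof. by move=> /prodf_neq0 n0 j; apply/eqP; rewrite -gray_coef_neq0 n0. Qed.

Lemma card_dual_term m (V : 'M_(m, 3)) s lam :
  dual_term V s lam != 0 -> #|s| = word_length V lam.
Proof.
by move=> /dual_term_neq0 e; rewrite card_col_type; apply: eq_bigr => j _; rewrite e.
Qed.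

Lemma dual_term_form m (V : 'M_(m, 3)) s lam : dual_term V s lam != 0 ->
  exists k, dual_term V s lam = 'i ^+ k * ((1 + 'i) / 2) ^+ odd_count V lam.
Proof.
move=> /prodf_neq0 n0; rewrite /dual_term /odd_count.
elim/big_rec2: _ => [|j q z _ [k ->]]; first by exists 0%N; rewrite mulr1.
have [k' ->] := gray_coef_form (n0 j isT).
by exists (k' + k)%N; rewrite !exprD mulrACA.
Qed.

(** All contributing dual words have the Lee weights prescribed by [s], hence agree up to sign, and
    opposite words give conjugate terms. *)
Lemma sum_dual_term m (V : 'M_(m, 3)) s lam : separating V -> dual_term V s lam != 0 ->
  \sum_lam' dual_term V s lam' =
  if lam == - lam then dual_term V s lam else dual_term V s lam + (dual_term V s lam)^*.
Proof.
move=> sepV n0; rewrite (bigD1 lam) //=.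
have other lam' : dual_term V s lam' != 0 -> lam' != lam -> lam' = - lam.
  move=> n0' ne; case: (@dual_word_separating _ V lam lam' sepV) => //; last first.
    by move=> e; rewrite e eqxx in ne.
  by move=> j; rewrite -(dual_term_neq0 n0) (dual_term_neq0 n0').
case: ifPn => [/eqP lamN | lamN].
  rewrite big1 ?addr0 // => lam' ne; apply/eqP; apply: contraTT (ne) => n0'.
  by rewrite (other _ n0' ne) -lamN eqxx.
rewrite (bigD1 (- lam)) /=; last by rewrite eq_sym.
rewrite dual_termN big1 ?addr0 // => lam' /andP[ne neN]; apply/eqP.
by apply: contraTT neN => n0'; rewrite (other _ n0' ne) eqxx.
Qed.

(** Truncated subtraction gives the value 1 when there is no odd coordinate, as for
    [lam = - lam]. *)
Definition word_aliasing m (V : 'M_(m, 3)) lam : rat := 2 ^- ((odd_count V lam).-1)./2.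

Lemma word_aliasing_gt0 m (V : 'M_(m, 3)) lam : 0 < word_aliasing V lam.
Proof. by rewrite invr_gt0 exprn_gt0. Qed.

Lemma word_aliasing_le1 m (V : 'M_(m, 3)) lam : word_aliasing V lam <= 1.
Proof. by rewrite invf_le1 ?exprn_gt0 // exprn_ege1. Qed.

Lemma aliasing_index_dual_term m (V : 'M_(m, 3)) s lam :
  separating V -> dual_term V s lam != 0 ->
  aliasing_index (qc_design V) s = 0 \/
  aliasing_index (qc_design V) s = word_aliasing V lam.
Proof.
move=> sepV n0; suff : ratr (aliasing_index (qc_design V) s) = 0 :> algC \/
    ratr (aliasing_index (qc_design V) s) = ratr (word_aliasing V lam) :> algC.
  by case=> [/eqP | /fmorph_inj]; [rewrite fmorph_eq0 => /eqP; left | right].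
rewrite aliasing_index_dual (sum_dual_term sepV n0) /word_aliasing.
rewrite fmorphV rmorphXn /= rmorph_nat.
have [k ->] := dual_term_form n0.
case: ifPn => [/eqP lamN | lamN].
  (* The only term is a power of i, of modulus 1. *)
  rewrite (eqN_odd_count V lamN) !mulr1 normrX normCi expr1n expr0 invr1.
  by right.
by apply: norm_half_1Di_exp; apply: leq_trans (neqN_odd_count sepV lamN).
Qed.

Lemma word_dual m (V : 'M_(m, 3)) (s : {set 'I_(3 + m) * bool}) : separating V -> (0 < #|s|)%N ->
  0 < aliasing_index (qc_design V) s ->
  exists2 lam, lam != 0 &
    #|s| = word_length V lam /\ aliasing_index (qc_design V) s = word_aliasing V lam.
Proof.
move=> sepV s_gt0 rho_gt0.
have [lam n0] : exists lam, dual_term V s lam != 0.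
  apply/existsP; apply: contraTT rho_gt0 => /existsPn T0.
  have := aliasing_index_dual V s; rewrite big1 => [|lam _]; last first.
    by apply/eqP; rewrite -[_ == _]negbK.
  by rewrite normr0 => /eqP; rewrite fmorph_eq0 => /eqP->; rewrite ltxx.
exists lam; last split.
- apply: contraTneq s_gt0 => lam0; rewrite (card_dual_term n0) lam0 /word_length.
  by rewrite big1 // => j _; rewrite /dual_word mul0mx oppr0 row_mx0 mxE.
- exact: card_dual_term.
by case: (aliasing_index_dual_term sepV n0) => // e; rewrite e ltxx in rho_gt0.
Qed.

(** * Realizing every dual word by a set of columns *)

(** An odd entry needs exactly one Gray coordinate, and [b] selects which; an even entry leaves no
    choice. *)
Definition dual_type (b : bool) (l : 'Z_4) : bool * bool :=
  if odd l then (b, ~~ b) else (l == 2, l == 2).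

Lemma gray_coef_dual_type b l : gray_coef (dual_type b l) l != 0.
Proof. by rewrite gray_coef_neq0; case: b; case: l => [[|[|[|[|[]]]]] ?]. Qed.

Definition set_of_type (A : finType) (tau : A -> bool * bool) : {set A * bool} :=
  [set c | if c.2 then (tau c.1).2 else (tau c.1).1].

Lemma col_type_set (A : finType) (tau : A -> bool * bool) j :
  col_type (set_of_type tau) j = tau j.
Proof. by rewrite /col_type !inE /=; case: (tau j). Qed.

Lemma aliasing_index_ge0 (Run Col : finType) (D : Run -> Col -> rat) s :
  0 <= aliasing_index D s.
Proof. by rewrite divr_ge0. Qed.

Lemma gray_coef_odd (l : 'Z_4) : odd l ->
  let c := gray_coef (true, false) l in
  [/\ gray_coef (false, true) l = c^*, c + c^* = 1 & (c - c^*) ^+ 2 = -1].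
Proof.
move=> + c; rewrite {}/c -gray_coefN; case: l => [[|[|[|[|[]]]]] ?] //= _;
  rewrite /gray_coef /= ?expr0 ?expr1.
all: by split=> //; field: (sqrCi algC).
Qed.

Lemma dual_word_attained m (V : 'M_(m, 3)) lam : separating V ->
  exists s : {set 'I_(3 + m) * bool},
    #|s| = word_length V lam /\ aliasing_index (qc_design V) s = word_aliasing V lam.
Proof.
move=> sepV.
pose S beta := set_of_type (fun j => dual_type (beta j) (dual_word V lam 0 j)).
have n0 beta : dual_term V (S beta) lam != 0.
  by apply/prodf_neq0 => j _; rewrite col_type_set gray_coef_dual_type.
suff [beta rho0] : exists beta, aliasing_index (qc_design V) (S beta) != 0.
  exists (S beta); rewrite (card_dual_term (n0 beta)); split=> //.
  by case: (aliasing_index_dual_term sepV (n0 beta)) => // e; rewrite e eqxx in rho0.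
suff [beta rho0] : exists beta, \sum_lam' dual_term V (S beta) lam' != 0.
  by exists beta; rewrite -(fmorph_eq0 (ratr : rat -> algC)) /= aliasing_index_dual normr_eq0.
have [lamN | lamN] := eqVneq lam (- lam).
  by exists xpredT; rewrite (sum_dual_term sepV (n0 _)) {1}lamN eqxx.
have [j0 oj0] := neqN_odd lamN.
(* The term c y of lam pairs with its conjugate, and flipping the Gray coordinate in one odd
   coordinate replaces c by its conjugate; y = 0 if c y and c^* y are both imaginary. *)
pose k0 := lshift m j0.
pose beta b j := if j == k0 then b else true.
pose y := \prod_(j | j != k0)
  gray_coef (dual_type true (dual_word V lam 0 j)) (dual_word V lam 0 j).
have Ty b : dual_term V (S (beta b)) lam = gray_coef (b, ~~ b) (lam 0 j0) * y.
  rewrite /dual_term /S (bigD1 k0) // col_type_set /beta eqxx dual_word_lshift /dual_type oj0.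
  by congr (_ * _); apply: eq_bigr => j /negPf jk; rewrite col_type_set jk.
have sumT b : \sum_lam' dual_term V (S (beta b)) lam' =
    gray_coef (b, ~~ b) (lam 0 j0) * y + (gray_coef (b, ~~ b) (lam 0 j0) * y)^*.
  by rewrite (sum_dual_term sepV (n0 _)) (negPf lamN) Ty.
have [e1|] := eqVneq (\sum_lam' dual_term V (S (beta true)) lam') 0; last by exists (beta true).
have [e2|] := eqVneq (\sum_lam' dual_term V (S (beta false)) lam') 0; last by exists (beta false).
(* The term of [lam] is nonzero, hence so is [y]; it remains to derive [y = 0] from the vanishing of
   both sums. *)
have := n0 (beta true); rewrite Ty mulf_eq0 negb_or => /andP[_ /eqP[]].
move: e1 e2; rewrite !sumT !rmorphM /negb.
set l := lam 0 j0; set c := gray_coef (true, false) l.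
have [-> cD cB] := gray_coef_odd (oj0 : odd l).
rewrite -/c /= conjCK => e1 e2.
(* With d the conjugate of c, the relations c + d = 1 and (c - d)^2 = -1 let y be written as a
   combination of the two vanishing sums. *)
have -> : y = - ((c - c^*) ^+ 2 * (c + c^*) * y) by rewrite cB cD mulr1 mulN1r opprK.
transitivity (- (c - c^*) * (c * (c * y + c^* * y^*) - c^* * (c^* * y + c * y^*))); first by ring.
by rewrite e1 e2 !mulr0 subr0 mulr0.
Qed.

(** * Resolution and maximal aliasing from dual words *)

Lemma word_length_gt0 m (V : 'M_(m, 3)) lam : lam != 0 -> (0 < word_length V lam)%N.
Proof.
apply: contraNltn; rewrite leqn0 sum_nat_eq0 => /forallP l0; apply/eqP/rowP => j.
have := l0 (lshift m j); rewrite dual_word_lshift mxE /=.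
by move: (lam 0 j) => x; case: (x : 'Z_4) => [[|[|[|[|[]]]]] ?] // _; apply: val_inj.
Qed.

Lemma has_word_dual m (V : 'M_(m, 3)) lam : separating V ->
  has_word_of_length (qc_design V) (word_length V lam).
Proof.
move=> sepV; have [s [card_s rho_s]] := dual_word_attained lam sepV.
by apply/existsP; exists s; rewrite card_s eqxx rho_s word_aliasing_gt0.
Qed.

Lemma shortest_word_length_min m (V : 'M_(m, 3)) lam : separating V -> lam != 0 ->
  (shortest_word_length V <= word_length V lam)%N.
Proof.
move=> sepV lam0; rewrite /shortest_word_length; case: ex_minnP => r _; apply.
by rewrite word_length_gt0 ?has_word_dual.
Qed.

Lemma max_shortest_aliasing_max m (V : 'M_(m, 3)) lam : separating V ->
  word_length V lam = shortest_word_length V ->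
  word_aliasing V lam <= max_shortest_aliasing V.
Proof.
rewrite /max_shortest_aliasing => sepV <-; have [s [card_s <-]] := dual_word_attained lam sepV.
by apply: le_bigmax_cond; rewrite card_s.
Qed.

Lemma max_shortest_aliasing_attained m (V : 'M_(m, 3)) : separating V ->
  exists lam, [/\ lam != 0, word_length V lam = shortest_word_length V
    & word_aliasing V lam = max_shortest_aliasing V].
Proof.
move=> sepV; rewrite /max_shortest_aliasing /shortest_word_length.
case: ex_minnP => r /andP[r_gt0 /existsP[s0 /andP[card_s0 rho_s0]]] _.
have le_max : aliasing_index (qc_design V) s0 <= max_aliasing_of_length (qc_design V) r.
  exact: le_bigmax_cond.
(* Nonnegativity of the aliasing indexes lets the maximum, whose default is 0, be attained at a
   set. *)
have [s card_s max_s] := eq_bigmax s0 (fun s => #|s| == r) (aliasing_index (qc_design V)) card_s0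
  (fun s _ => aliasing_index_ge0 (qc_design V) s).
have rho_gt0 : 0 < aliasing_index (qc_design V) s.
  by rewrite -max_s; apply: lt_le_trans rho_s0 le_max.
have s_eq : #|s| = r by apply/eqP.
have s_gt0 : (0 < #|s|)%N by rewrite s_eq.
have [lam lam0 [card_lam rho_lam]] := word_dual sepV s_gt0 rho_gt0.
by exists lam; rewrite /max_aliasing_of_length max_s -card_lam s_eq.
Qed.

(** * Effect of adding [t] copies of the nonzero rows *)

Lemma word_length_shift m m' (V : 'M_(m, 3)) (V' : 'M_(m', 3)) lam t : lam != 0 ->
  frequency_vector V' = [ffun w => if w == (0, 0, 0) then frequency_vector V w
                                   else (frequency_vector V w + t)%N] ->
  word_length V' lam = (word_length V lam + 64 * t)%N.
Proof.
move=> lam0 FV'; rewrite /word_length (sum_dual_word_shift _ _ _ FV') //; last exact: leeN.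
rewrite sum_lee_dot 1?mulnC //; apply: contraNneq lam0 => e.
by apply/eqP/triple_inj; rewrite e /row_triple !mxE.
Qed.

Lemma odd_count_shift m m' (V : 'M_(m, 3)) (V' : 'M_(m', 3)) lam t : lam != - lam ->
  frequency_vector V' = [ffun w => if w == (0, 0, 0) then frequency_vector V w
                                   else (frequency_vector V w + t)%N] ->
  odd_count V' lam = (odd_count V lam + 32 * t)%N.
Proof.
move=> lamN FV'; pose f (x : 'Z_4) : nat := odd x.
rewrite /odd_count (sum_dual_word_shift (f := f) _ _ _ FV') // => [|x].
  rewrite sum_odd_dot 1?mulnC //; apply: contraNneq lamN => e.
  by apply/eqP/triple_inj; rewrite triple_opp.
by rewrite /f oddZ4N.
Qed.

Lemma word_aliasing_shift m m' (V : 'M_(m, 3)) (V' : 'M_(m', 3)) lam t :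
  separating V -> lam != - lam ->
  frequency_vector V' = [ffun w => if w == (0, 0, 0) then frequency_vector V w
                                   else (frequency_vector V w + t)%N] ->
  word_aliasing V' lam = word_aliasing V lam * 2 ^- (16 * t).
Proof.
move=> sepV lamN FV'; rewrite /word_aliasing (odd_count_shift lamN FV') -invfM -exprD.
(* A positive odd count is needed here: only then does [.-1] commute with adding [32 * t], whose
   half is [16 * t]. *)
have := neqN_odd_count sepV lamN.
by case: (odd_count V lam) => // q _; congr (_ ^- _); lia.
Qed.

(** An odd count of at least 3 makes the exponent at least 1. *)
Lemma word_aliasing_lt1 m (V : 'M_(m, 3)) lam : separating V ->
  (word_aliasing V lam < 1) = (lam != - lam).
Proof.
move=> sepV; have [lamN | lamN] := eqVneq.
  by rewrite /word_aliasing (eqN_odd_count V lamN) expr0 invr1 ltxx.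
have := neqN_odd_count sepV lamN; rewrite /word_aliasing.
case: (odd_count V lam) => [|[|[|q]]] // _.
by rewrite invf_lt1 ?exprn_gt0 // exprn_egt1.
Qed.

Theorem theorem4 (n : nat) (F0 : {ffun 'Z_4 * 'Z_4 * 'Z_4 -> nat})
    (V0 : 'M['Z_4]_(n, 3)) (r0 : nat) (rho0 : rat) :
  frequency_vector V0 = F0 ->
  (0 < \sum_(i <- Z4_odd) \sum_(j <- Z4_odd) \sum_(k <- Z4_even)
         F0 (i, j, k))%N ->
  (0 < \sum_(i <- Z4_odd) \sum_(j <- Z4_even) \sum_(k <- Z4_odd)
         F0 (i, j, k))%N ->
  (0 < \sum_(i <- Z4_even) \sum_(j <- Z4_odd) \sum_(k <- Z4_odd)
         F0 (i, j, k))%N ->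
  shortest_word_length V0 = r0 ->
  max_shortest_aliasing V0 = rho0 ->
  forall (t : nat) (Vt : 'M['Z_4]_(n + 63 * t, 3)),
  frequency_vector Vt =
    [ffun w => if w == (0, 0, 0) then F0 w else (F0 w + t)%N] ->
  exists (rt : nat) (rhot : rat),
    [/\ shortest_word_length Vt = rt /\ max_shortest_aliasing Vt = rhot,
        generalized_resolution Vt = rt%:R + 1 - rhot,
        rt = (r0 + 64 * t)%N,
        rho0 < 1 -> rhot = rho0 * 2 ^- (16 * t)
      & rho0 = 1 -> rhot = 1].
Proof.
move=> <- {F0} F1 F2 F3 <- <- t Vt FVt.
have sep0 : separating V0 by apply: separating_frequency.
(* No frequency decreases, so the parity hypotheses persist. *)
have sept : separating Vt.
  have le_F w : (frequency_vector V0 w <= frequency_vector Vt w)%N.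
    by rewrite FVt [leqRHS]ffunE; case: (w == _); rewrite ?leq_addr.
  by apply: (@separating_frequency _ Vt); [apply: leq_trans F1 _ | apply: leq_trans F2 _
    | apply: leq_trans F3 _]; do 3!(apply: leq_sum => ? _).
have shift lam (nz : lam != 0) := word_length_shift nz FVt.
have [lam0 [nz0 r0E rho0E]] := max_shortest_aliasing_attained sep0.
have [lamt [nzt rtE rhotE]] := max_shortest_aliasing_attained sept.
(* All nonzero [lam] gain the same length, so the minimum shifts by that amount and the minimizers
   stay the same. *)
have rt_eq : shortest_word_length Vt = (shortest_word_length V0 + 64 * t)%N.
  apply/eqP; rewrite eqn_leq; apply/andP; split.
    by rewrite -r0E -shift // shortest_word_length_min.
  by rewrite -rtE shift // leq_add2r shortest_word_length_min.
have mint : word_length V0 lamt = shortest_word_length V0.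
  by apply/eqP; rewrite -(eqn_add2r (64 * t)) -shift // rtE rt_eq.
have min0 : word_length Vt lam0 = shortest_word_length Vt by rewrite shift // r0E rt_eq.
exists (shortest_word_length Vt), (max_shortest_aliasing Vt); split=> //.
  (* If [rho0 < 1], no minimizer equals its opposite, so all their aliasing indexes scale by the
     same factor. *)
  move=> rho_lt1; have odd_lam lam : word_length V0 lam = shortest_word_length V0 -> lam != - lam.
    move=> min; rewrite -(word_aliasing_lt1 _ sep0).
    exact: le_lt_trans (max_shortest_aliasing_max sep0 min) rho_lt1.
  apply/le_anti/andP; split.
    rewrite -rhotE (word_aliasing_shift sep0 (odd_lam _ mint) FVt) ler_pM2r.
      exact: max_shortest_aliasing_max.
    by rewrite invr_gt0 exprn_gt0.
  rewrite -rho0E -(word_aliasing_shift sep0 (odd_lam _ r0E) FVt).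
  exact: max_shortest_aliasing_max.
(* If [rho0 = 1], the minimizer [lam0] equals its opposite; this does not depend on [t], so its
   aliasing index stays 1. *)
move=> rho1; have := word_aliasing_lt1 lam0 sep0; rewrite rho0E rho1 ltxx => /esym.
rewrite -(word_aliasing_lt1 lam0 sept) => lam0_ge1.
apply/le_anti; rewrite -{1}rhotE word_aliasing_le1 /=.
apply: le_trans (max_shortest_aliasing_max sept min0).
by rewrite leNgt lam0_ge1.
Qed.
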